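(* Let $\ell$ be a positive integer with $\ell<3$. Then there exists no graph $G$ with an edge $e\in E(G)$ such that $\gamma_g(G)=\ell$ and $\gamma_g(G-e)=\ell+2$.
   Context: Graphs are finite, simple and undirected. A vertex dominates itself and all its neighbors. The domination game on a graph $G$ is played by two players, Dominator and Staller, who alternately choose a vertex of $G$ such that each chosen vertex dominates at least one vertex that was not dominated by the previously chosen vertices. The game ends when all vertices of $G$ are dominated. Dominator wants the total number of chosen vertices to be as small as possible, Staller wants it to be as large as possible. Assuming both play optimally, $\gamma_g(G)$ (the game domination number) is the total number of vertices chosen when Dominator moves first. $G-e$ denotes the graph obtained from $G$ by removing the edge $e$ (keeping all vertices). *)

(* Defs.v *)
From mathcomp Require Import all_boot.

Set Implicit Arguments.
Unset Strict Implicit.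
Unset Printing Implicit Defensive.

Record sgraph := SGraph {
  vertex :> finType;
  adj : rel vertex;
  adj_sym : symmetric adj;
  adj_irrefl : irreflexive adj
}.

Definition edges (G : sgraph) : {set {set G}} :=
  [set [set x; y] | x in G, y in G & adj x y].

Lemma edgesP (G : sgraph) (e : {set G}) :
  reflect (exists x y, adj x y /\ e = [set x; y]) (e \in edges G).
Proof.
apply: (iffP imset2P) => [[x y _] | [x [y [xy ->]]]].
  by rewrite inE => /andP[_ xy] ->; exists x, y.
by exists x y; rewrite ?inE.
Qed.

Section EdgeRemoval.
Variables (G : sgraph) (e : {set G}).

Definition del_edge_rel : rel G := [rel x y | adj x y && ([set x; y] != e)].

Lemma del_edge_sym : symmetric del_edge_rel.
Proof. by move=> x y; rewrite /del_edge_rel /= adj_sym setUC. Qed.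

Lemma del_edge_irrefl : irreflexive del_edge_rel.
Proof. by move=> x; rewrite /del_edge_rel /= adj_irrefl. Qed.

Definition del_edge : sgraph := SGraph del_edge_sym del_edge_irrefl.

End EdgeRemoval.

Inductive player := Dominator | Staller.

Definition opponent (p : player) : player :=
  if p is Dominator then Staller else Dominator.

Section DominationGame.
Variable G : sgraph.
Implicit Types (S : {set G}) (v : G) (p : player).

Definition closed_nbh v : {set G} := [set u | (u == v) || adj v u].

Definition dominated S : {set G} := \bigcup_(v in S) closed_nbh v.

Definition legal S v : bool := ~~ (closed_nbh v \subset dominated S).

(* Number of moves still to be made under optimal play, when S is the set of  *)
(* vertices chosen so far and p is to move. There is no legal move exactly    *)
(* when every vertex is dominated (no_legal), so v0 only witnesses that the   *)
(* game is not over. The recursion is on a bound n on the number of moves;    *)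
(* a legal move is never in S, so any n >= #|~: S| gives the same value       *)
(* (moves_left_fuel).                                                         *)
Fixpoint moves_left (n : nat) p S : nat :=
  if n is n'.+1 then
    if [pick v | legal S v] is Some v0 then
      let after v := moves_left n' (opponent p) (v |: S) in
      (if p is Dominator then after [arg min_(v < v0 | legal S v) after v]
       else after [arg max_(v > v0 | legal S v) after v]).+1
    else 0
  else 0.

Definition gamma_g : nat := moves_left #|G| Dominator set0.

Lemma no_legal S : (forall v, ~~ legal S v) <-> dominated S = setT.
Proof.
split=> [noS | domS v]; last by rewrite negbK domS subsetT.
apply/setP=> v; rewrite inE; have := noS v; rewrite negbK => /subsetP-> //.
by rewrite inE eqxx.
Qed.

Lemma legal_notin S v : legal S v -> v \notin S.
Proof. by apply: contra => vS; apply: bigcup_sup. Qed.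

Lemma moves_left_fuel n p S :
  #|~: S| <= n -> moves_left n p S = moves_left #|~: S| p S.
Proof.
have [m leSm] := ubnP #|~: S|; elim: m => // m IHm in n p S leSm *.
have card_legal v : legal S v -> #|~: S| = #|~: (v |: S)|.+1.
  by move/legal_notin=> vS; rewrite (cardsD1 v) inE vS setCU setIC -setDE.
case: n => [|n]; first by rewrite leqn0 => /eqP->.
move=> leSn; rewrite /=; case: pickP => [v0 lv0 | no_v]; last first.
  by case: #|~: S| => //= k; case: pickP => // v; rewrite no_v.
rewrite (card_legal _ lv0) /=; case: pickP => [v1 lv1 | /(_ v0)]; last first.
  by rewrite lv0.
have eq_after v : legal S v -> moves_left n (opponent p) (v |: S)
      = moves_left #|~: (v0 |: S)| (opponent p) (v |: S).
  move=> lv; have cv := card_legal v lv; have := card_legal v0 lv0.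
  rewrite cv => -[<-]; apply: IHm; first by rewrite -ltnS -cv.
  by rewrite -ltnS -cv.
congr _.+1; case: p eq_after => eq_after.
- case: arg_minnP => // a la mina; case: arg_minnP => // b lb minb.
  apply/anti_leq/andP; split; first by rewrite -(eq_after b lb); apply: mina.
  by rewrite (eq_after a la); apply: minb.
- case: arg_maxnP => // a la maxa; case: arg_maxnP => // b lb maxb.
  apply/anti_leq/andP; split; first by rewrite (eq_after a la); apply: maxb.
  by rewrite -(eq_after b lb); apply: maxa.
Qed.

End DominationGame.

(* Main.v *)
Require Import Defs.
From mathcomp Require Import all_boot.

(** If Dominator can win on [G] within two moves by opening with [v], then any
    closed neighbourhood that meets the complement [U] of [N[v]] contains [U].
    Dominator opens with the same [v] on [G - e]. Whatever Staller answers,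
    any vertex [t] still undominated then dominates all the remaining ones, so
    that a third move at [t] ends the game. If [v] is universal in [G], at most
    one vertex is undominated after [v] in [G - e], and Staller's answer ends
    the game. *)

Set Implicit Arguments.
Unset Strict Implicit.
Unset Printing Implicit Defensive.

Lemma set2_injr (T : finType) (x y z : T) :
  [set x; y] = [set x; z] -> y = z.
Proof.
move=> eq_s; have: y \in [set x; z] by rewrite -eq_s set22.
have: z \in [set x; y] by rewrite eq_s set22.
by rewrite !inE => /orP[/eqP-> | /eqP->] // /orP[] /eqP.
Qed.

Section Game.
Variable G : sgraph.
Implicit Types (S : {set G}) (u v : G).

Lemma closed_nbh_refl v : v \in closed_nbh v.
Proof. by rewrite inE eqxx. Qed.

Lemma dominated0 : dominated (set0 : {set G}) = set0.
Proof. exact: big_set0. Qed.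

Lemma dominated1 v : dominated [set v] = closed_nbh v.
Proof. exact: big_set1. Qed.

Lemma dominatedU1 v S : dominated (v |: S) = closed_nbh v :|: dominated S.
Proof. by rewrite /dominated bigcup_setU big_set1. Qed.

Lemma legalP S v :
  reflect (exists2 z, z \in closed_nbh v & z \notin dominated S) (legal S v).
Proof. exact: subsetPn. Qed.

Lemma dominated_illegal S v : ~~ legal S v -> dominated (v |: S) = dominated S.
Proof. by rewrite negbK dominatedU1 => /setUidPr. Qed.

(** Strategies as quantifiers, in place of the optima in [moves_left]. For positive [k] only
    Dominator's clause has to mention a finished game, since such a game leaves Staller's quantifier
    vacuous. *)
Fixpoint ends_within (k : nat) (p : player) (S : {set G}) : Prop :=
  if k is k'.+1 then
    match p with
    | Dominator => dominated S = setT \/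
        exists2 v, legal S v & ends_within k' Staller (v |: S)
    | Staller => forall v, legal S v -> ends_within k' Dominator (v |: S)
    end
  else dominated S = setT.

Lemma ends_within_dominated k p S : dominated S = setT -> ends_within k p S.
Proof.
case: k p => [|k] [] //= domS; first by left.
by move=> v; rewrite (negPf ((no_legal S).2 domS v)).
Qed.

(** A minimum is at most [k] when some move achieves this, a maximum when all moves do. Each legal
    move shrinks [~: S], so the fuel [n] lasts until the game ends. *)
Lemma moves_left_leP n k p S :
  #|~: S| <= n -> (moves_left n p S <= k <-> ends_within k p S).
Proof.
elim: n k p S => [|n IHn] k p S leSn.
  split=> // _; apply: ends_within_dominated; apply/no_legal => v.
  apply/negP => /legal_notin vS; move: leSn; rewrite leqn0 cards_eq0 => /eqP S0.
  by have := in_set0 v; rewrite -S0 inE vS.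
have le_after v : legal S v -> #|~: (v |: S)| <= n.
  move/legal_notin => vS; move: leSn.
  by rewrite (cardsD1 v) inE vS setCU setIC -setDE.
rewrite /=; case: pickP => [v0 lv0 | no_v]; last first.
  split=> // _; apply: ends_within_dominated; apply/no_legal => v.
  by rewrite no_v.
case: k => [|k].
  by split=> //= domS; have := (no_legal S).2 domS v0; rewrite lv0.
rewrite ltnS; case: p => /=.
- case: arg_minnP => // a la mina; split=> [le_a | [domS | [v lv ev]]].
  + by right; exists a => //; apply/IHn; first exact: le_after.
  + by have := (no_legal S).2 domS v0; rewrite lv0.
  + by apply: leq_trans (mina v lv) _; apply/IHn; first exact: le_after.
- case: arg_maxnP => // a la maxa; split=> [le_a v lv | ev].
  + by apply/IHn; [exact: le_after | exact: leq_trans (maxa v lv) le_a].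
  + by apply/IHn; [exact: le_after | exact: ev].
Qed.

Lemma gamma_g_leP k : gamma_g G <= k <-> ends_within k Dominator (set0 : {set G}).
Proof. by apply: moves_left_leP; rewrite max_card. Qed.

Lemma legal0 v : legal set0 v.
Proof. by apply/legalP; exists v; rewrite ?closed_nbh_refl ?dominated0 ?inE. Qed.

(** The vertex [a] rules out the empty graph, where the game ends with no move. *)
Lemma gamma_g_le1 (a : G) : gamma_g G <= 1 -> exists v, closed_nbh v = setT.
Proof.
move/gamma_g_leP => /= [|[v _]]; last by rewrite setU0 dominated1; exists v.
by rewrite dominated0 => /setP/(_ a); rewrite !inE.
Qed.

Lemma gamma_g_le2P (a : G) :
  gamma_g G <= 2 <->
  exists v, forall u, legal [set v] u -> closed_nbh u :|: closed_nbh v = setT.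
Proof.
split=> [/gamma_g_leP /= [|[v _ ev]] | [v ev]].
- by rewrite dominated0 => /setP/(_ a); rewrite !inE.
- by exists v => u; rewrite -(dominated1 v) -dominatedU1 -(setU0 [set v]) => /ev.
apply/gamma_g_leP; right; exists v => [|u]; first exact: legal0.
by rewrite setU0 /= dominatedU1 dominated1 => /ev.
Qed.

Lemma gamma_g_le3 v :
  (forall u, legal [set v] u ->
     exists w, closed_nbh w :|: (closed_nbh u :|: closed_nbh v) = setT) ->
  gamma_g G <= 3.
Proof.
move=> ev; apply/gamma_g_leP; right; exists v => [|u]; first exact: legal0.
rewrite setU0 => /ev[w]; rewrite -(dominated1 v) -!dominatedU1 => domw.
have [lw | nlw] := boolP (legal (u |: [set v]) w).
  by right; exists w => //; apply: ends_within_dominated.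
(* An illegal [w] dominates nothing new, so the game was already over. *)
by left; rewrite -(dominated_illegal nlw).
Qed.

End Game.

Section EdgeRemoval.
Variables (G : sgraph) (e : {set G}).
Let N (v : G) : {set G} := closed_nbh v.
Let N' (v : G) : {set G} := @closed_nbh (del_edge e) v.

Lemma closed_nbh_del_edge_sub v : N' v \subset N v.
Proof.
apply/subsetP => u; rewrite !inE => /orP[-> // | /andP[-> _]].
by rewrite orbT.
Qed.

(** Every loss identifies [e], so by [set2_injr] two vertices lost at the same [v] coincide. *)
Lemma closed_nbh_del_edge_lost v u :
  u \in N v -> u \notin N' v -> [set v; u] = e.
Proof.
rewrite !inE negb_or => /orP[-> // | uv] /andP[_].
by rewrite /= /del_edge_rel /= uv negbK => /eqP.
Qed.

Lemma gamma_g_del_edge_le2 (a : G) :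
  gamma_g G <= 1 -> gamma_g (del_edge e) <= 2.
Proof.
case/(gamma_g_le1 a) => v univ_v.
have lost t : t \notin N' v -> [set v; t] = e.
  by apply: closed_nbh_del_edge_lost; rewrite /N univ_v inE.
apply/(@gamma_g_le2P (del_edge e) a); exists v => u /legalP[z uz].
rewrite dominated1 => /lost vz; apply/setP => t; rewrite inE [RHS]inE.
have [//|/lost vt] := boolP (t \in N' v); first by rewrite orbT.
(* Both [t] and [z] are lost at [v], hence equal, and [u] dominates [z]. *)
by rewrite (set2_injr (etrans vt (esym vz))) uz.
Qed.

Lemma gamma_g_del_edge_le3 (a : G) :
  gamma_g G <= 2 -> gamma_g (del_edge e) <= 3.
Proof.
case/(gamma_g_le2P a) => v ev.
(* In [G], the vertex [z] makes [u] a legal answer to [v], and that answer must end the game. *)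
have meetU u z t : z \in N u -> z \notin N v -> t \notin N v -> t \in N u.
  move=> uz vz vt; have lu: legal [set v] u.
    by apply/legalP; exists z; rewrite ?dominated1.
  by have /setP/(_ t) := ev u lu; rewrite !in_setU in_setT (negPf vt) orbF.
apply: (@gamma_g_le3 (del_edge e) v) => u /legalP[z uz'].
rewrite dominated1 => vz'.
have uz := subsetP (closed_nbh_del_edge_sub u) z uz'.
have [all_dom | [t]] := set_0Vmem (~: (N' u :|: N' v)).
  (* Nothing is left to dominate, so any third vertex will do. *)
  by exists v; rewrite -[X in _ :|: X]setCK all_dom setC0 setUT.
rewrite in_setC in_setU negb_or => /andP[ut' vt'].
exists t; apply/setP => s; rewrite !in_setU in_setT.
(* Suppose [t] misses some [s] that is still undominated; the cases are whether [s] and [t] lie in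
   [N v]. *)
apply/negPn/negP; rewrite !negb_or => /and3P[ts' us' vs'].
have vv : v \in N v := closed_nbh_refl v.
(* Both ends of an edge at [v] lie in [N v], so [e] cannot be such an edge
   once it has an end outside. *)
have ne x y q : x \in N v -> q \notin N v -> [set v; x] <> [set y; q].
  move=> xv qv eq_s; have: q \in [set v; x] by rewrite eq_s set22.
  by rewrite !inE => /orP[] /eqP qx; rewrite qx ?vv ?xv in qv.
(* A vertex cut off from [v] by the deletion of [e] is the only new one, and
   then Staller's move reaches it or dominates all of [U]. *)
have mixed x y : x \in N v -> x \notin N' v -> x \notin N' u ->
                 y \notin N v -> y \notin N' u -> False.
  move=> vx vx' ux' vy uy'; have eqe := closed_nbh_del_edge_lost vx vx'.
  have [uy | /negP nuy] := boolP (y \in N u).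
    by case: (ne x u y vx vy); rewrite eqe (closed_nbh_del_edge_lost uy uy').
  have [vz | nvz] := boolP (z \in N v); last exact: nuy (meetU u z y uz nvz vy).
  have eqz := closed_nbh_del_edge_lost vz vz'.
  by move: ux'; rewrite (set2_injr (etrans eqe (esym eqz))) uz'.
have [vs | nvs] := boolP (s \in N v); have [vt | nvt] := boolP (t \in N v).
- have := closed_nbh_del_edge_lost vs vs'.
  rewrite -(closed_nbh_del_edge_lost vt vt') => /set2_injr st.
  by move: ts'; rewrite st closed_nbh_refl.
- exact: mixed vs vs' us' nvt ut'.
- exact: mixed vt vt' ut' nvs us'.
(* Here [e] joins [t] to [s], both outside [N v], so [z] cannot be lost at [v] and lies outside
   [N v] too. Then [u] reaches [s] and [t] in [G] and loses both, which forces [s = t]. *)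
have ts : s \in N t := meetU t t s (closed_nbh_refl t) nvt nvs.
have eqe := closed_nbh_del_edge_lost ts ts'.
have [vz | nvz] := boolP (z \in N v).
  by case: (ne z t s vz nvs); rewrite eqe (closed_nbh_del_edge_lost vz vz').
have eqs := closed_nbh_del_edge_lost (meetU u z s uz nvz nvs) us'.
have eqt := closed_nbh_del_edge_lost (meetU u z t uz nvz nvt) ut'.
move: ts'; rewrite (set2_injr (etrans eqs (esym eqt))).
by rewrite closed_nbh_refl.
Qed.

End EdgeRemoval.

Theorem mainTheorem13 (l : nat) (l_gt0 : 0 < l) (l_lt3 : l < 3) :
  ~ exists (G : sgraph) (e : {set G}),
      [/\ e \in edges G, gamma_g G = l & gamma_g (del_edge e) = l + 2].
Proof.
case=> G [e [/edgesP[a _] gG gGe]].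
(* For [l] equal to 1 or 2, the value [l + 2] exceeds the bound, 2 or 3, by one. *)
case: l l_gt0 l_lt3 gG gGe => [|[|[|l]]] // _ _ gG gGe.
- by have := @gamma_g_del_edge_le2 G e a; rewrite gG gGe => /(_ isT).
- by have := @gamma_g_del_edge_le3 G e a; rewrite gG gGe => /(_ isT).
Qed.
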